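(* Fix $\epsilon\in(0,1)$ and let $N=N(n)>n$ be a sequence of positive integers. For each $n$, let $X_1,\ldots,X_N$ be independent random points uniformly distributed on $B_2^n$ and set $B_{N,n}:=\mathrm{conv}\{X_1,\ldots,X_N\}$. Then $$\lim_{n\to\infty}\frac{\mathbb{E}\,V_n(B_{N,n})}{V_n(B_2^n)}=\begin{cases}0 & \text{if } N\le \exp\left((1-\epsilon)\frac{n+1}{2}\log n\right)\text{ for all sufficiently large } n,\\ 1 & \text{if } N\ge \exp\left((1+\epsilon)\frac{n+1}{2}\log n\right)\text{ for all sufficiently large } n.\end{cases}$$
   Context: $B_2^n$ is the closed Euclidean unit ball in $\mathbb{R}^n$ and $V_n$ is $n$-dimensional Lebesgue measure. *)

(* Defs.v *)
From HB Require Import structures.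
From mathcomp Require Import all_boot all_order all_algebra.
From mathcomp Require Import all_classical all_reals all_analysis.

Set Implicit Arguments.
Unset Strict Implicit.
Unset Printing Implicit Defensive.

Import Order.TTheory GRing.Theory Num.Theory.
Import numFieldNormedType.Exports.

Local Open Scope classical_set_scope.
Local Open Scope ring_scope.

Definition measure_rV_display : measure_display -> measure_display.
Proof. exact. Qed.

Section measurable_rV.
Context {d} {T : measurableType d}.
Variable n : nat.

Let coor : 'I_n -> 'rV[T]_n -> T := fun i v => v ord0 i.

Let rV_set0 : g_sigma_preimage coor set0.
Proof. exact: sigma_algebra0. Qed.

Let rV_setC A : g_sigma_preimage coor A -> g_sigma_preimage coor (~` A).
Proof. exact: sigma_algebraC. Qed.

Let rV_bigcup (F : _^nat) : (forall i, g_sigma_preimage coor (F i)) ->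
  g_sigma_preimage coor (\bigcup_i (F i)).
Proof. exact: sigma_algebra_bigcup. Qed.

(* The product sigma-algebra, generated by the coordinate maps; on 'rV[R]_n
   with R real it is the Borel sigma-algebra of R^n. *)
HB.instance Definition _ := @isMeasurable.Build (measure_rV_display d)
  'rV[T]_n (g_sigma_preimage coor) rV_set0 rV_setC rV_bigcup.

End measurable_rV.

Section measurable_fun_rV.
Context d d' (T : measurableType d) (T' : measurableType d') (n : nat).

Lemma measurable_rV_coord (i : 'I_n) :
  measurable_fun [set: 'rV[T]_n] (fun v => v ord0 i).
Proof.
move=> _ Y mY; rewrite setTI; apply: sub_sigma_algebra => /=.
rewrite -bigcup_seq/=; exists i => /=; first by rewrite mem_index_enum.
by exists Y => //; rewrite setTI.
Qed.

Lemma measurable_rV_box (A : 'I_n -> set T) : (forall i, measurable (A i)) ->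
  measurable [set v : 'rV[T]_n | forall i, A i (v ord0 i)].
Proof.
move=> mA.
rewrite (_ : mkset _ =
    \bigcap_(i in [set` finset.setT]) ((fun v : 'rV[T]_n => v ord0 i) @^-1` A i)).
  apply: fin_bigcap_measurable => // i _.
  by rewrite -[X in measurable X]setTI; exact: measurable_rV_coord.
by apply/seteqP; split => v /= vA i; [move=> _; exact: vA|apply: vA; rewrite /= inE].
Qed.

Lemma measurable_fun_rV (f : T' -> 'rV[T]_n) :
  (forall i, measurable_fun [set: T'] (fun x => f x ord0 i)) ->
  measurable_fun [set: T'] f.
Proof.
move=> mf.
pose C : set (set 'rV[T]_n) :=
  \big[setU/set0]_(i < n) preimage_set_system setT
    (fun v : 'rV[T]_n => v ord0 i) measurable.
have mE : @measurable _ 'rV[T]_n = <<s C >> by [].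
apply: (measurability C mE).
move=> _ [A + <-]; rewrite /C -bigcup_seq/= => -[i _ [B mB <-]].
rewrite !setTI -comp_preimage/=.
by have := mf i measurableT B mB; rewrite setTI.
Qed.

End measurable_fun_rV.

Section lebesgue_measure_rV.
Context {R : realType}.

Section cons.
Variable n : nat.

Definition rV_cons (p : measurableTypeR R * 'rV[R]_n) : 'rV[R]_n.+1 :=
  row_mx (p.1 : R)%:M p.2.

Lemma rV_cons0 p : rV_cons p ord0 ord0 = p.1.
Proof.
rewrite /rV_cons mxE; case: splitP => [j _|j] //=.
by rewrite mxE (ord1 j).
Qed.

Lemma rV_consS p i : rV_cons p ord0 (lift ord0 i) = p.2 ord0 i.
Proof.
rewrite /rV_cons mxE; case: splitP => [[[]]//|j] /= [ij].
by congr (p.2 _ _); exact/val_inj.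
Qed.

Lemma measurable_rV_cons :
  measurable_fun [set: (measurableTypeR R * 'rV[R]_n)%type] rV_cons.
Proof.
apply: measurable_fun_rV => i.
case: (unliftP ord0 i) => [j|] ->.
  under eq_fun do rewrite rV_consS.
  apply: (measurableT_comp (f := fun v : 'rV[R]_n => v ord0 j)) => //.
  exact: measurable_rV_coord.
under eq_fun do rewrite rV_cons0.
exact: measurable_fst.
Qed.

End cons.

Section step.
Variables (n : nat) (mu : {sigma_finite_measure set 'rV[R]_n -> \bar R}).

Definition measure_rV_cons : set 'rV[R]_n.+1 -> \bar R :=
  pushforward (lebesgue_measure \x mu)%E (@rV_cons n).

Let pm : {measure set _ -> \bar R} :=
  measure_function_pushforward__canonical__measure_function_Measure
    (lebesgue_measure \x mu)%E (@measurable_rV_cons n).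

HB.instance Definition _ := isMeasure.Build _ _ _ measure_rV_cons
  (measure0 pm) (measure_ge0 pm) (@measure_semi_sigma_additive _ _ _ pm).

(* Proved from the factors: the canonical sigma-finite structure on products
   m1 \x m2 found by unification is the one for pairs of subprobabilities. *)
Let measure_rV_cons_sigma_finite : sigma_finite setT measure_rV_cons.
Proof.
have /sigma_finiteP[F [FT ndF Foo]] :=
  sigma_finiteT (@lebesgue_measure R : {sigma_finite_measure set _ -> \bar R}).
have /sigma_finiteP[G [GT ndG Goo]] := sigma_finiteT mu.
pose rV_uncons (v : 'rV[R]_n.+1) : measurableTypeR R * 'rV[R]_n :=
  (v ord0 ord0, \row_i v ord0 (lift ord0 i)).
have consK : cancel (@rV_cons n) rV_uncons.
  move=> [x v]; congr pair; first exact: rV_cons0.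
  by apply/rowP => i; rewrite mxE rV_consS.
have muncons : measurable_fun setT rV_uncons.
  apply: measurable_fun_pair; first exact: measurable_rV_coord.
  apply: measurable_fun_rV => i; under eq_fun do rewrite mxE.
  exact: measurable_rV_coord.
exists (fun k => rV_uncons @^-1` (F k `*` G k)).
  apply/esym; rewrite -subTset => v _.
  have [i _ Fi] : (\bigcup_k F k) (rV_uncons v).1 by rewrite -FT.
  have [j _ Gj] : (\bigcup_k G k) (rV_uncons v).2 by rewrite -GT.
  exists (maxn i j) => //; split.
    by move: Fi; exact/subsetPset/ndF/leq_maxl.
  by move: Gj; exact/subsetPset/ndG/leq_maxr.
move=> k; have [mF Fk] := Foo k; have [mG Gk] := Goo k; split.
  by rewrite -[X in measurable X]setTI; apply: muncons => //; exact: measurableX.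
rewrite /measure_rV_cons /pushforward -comp_preimage.
rewrite (_ : _ \o _ = id) ?preimage_id; last by apply/funext => p /=; exact: consK.
by rewrite product_measure1E// lte_mul_pinfty// ge0_fin_numE.
Qed.

HB.instance Definition _ := Measure_isSigmaFinite.Build _ _ _ measure_rV_cons
  measure_rV_cons_sigma_finite.

End step.

(* The n-fold product of the one-dimensional Lebesgue measure, on Borel sets;
   see lebesgue_measure_rV_box below. *)
Fixpoint lebesgue_measure_rV n : {sigma_finite_measure set 'rV[R]_n -> \bar R} :=
  if n is m.+1 then measure_rV_cons (lebesgue_measure_rV m)
  else \d_(0 : 'rV[R]_0).

Lemma lebesgue_measure_rV_box n (A : 'I_n -> set R) :
  (forall i, measurable (A i)) ->
  lebesgue_measure_rV n [set v | forall i, A i (v ord0 i)] =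
  (\prod_(i < n) lebesgue_measure (A i))%E.
Proof.
elim: n A => [|n IH] A mA /=.
  by rewrite big_ord0 diracE mem_set//= => -[].
rewrite big_ord_recl -IH// -product_measure1E//; first last.
- by apply: (@measurable_rV_box _ R n (fun i => A (lift ord0 i))) => i; exact: mA.
- exact: mA.
rewrite /measure_rV_cons /pushforward/=; congr (_ _).
apply/seteqP; split => [p /= pA|p /= [pA0 pA] i].
  split; first by have := pA ord0; rewrite rV_cons0.
  by move=> i; have := pA (lift ord0 i); rewrite rV_consS.
by case: (unliftP ord0 i) => [j|] ->; rewrite ?rV_cons0 ?rV_consS.
Qed.

End lebesgue_measure_rV.

(* The norm of the library on 'rV[R]_n is the sup norm. *)
Definition enorm {R : realType} {n} (v : 'rV[R]_n) : R :=
  Num.sqrt (\sum_(i < n) v ord0 i ^+ 2).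

Definition unit_ball (R : realType) n : set 'rV[R]_n := [set v | enorm v <= 1].
Arguments unit_ball : clear implicits.

Definition convex_hull {R : numDomainType} {M : lmodType R} (A : set M) :
  set M := smallest (@convex_set R M) A.

Section random_points.
Context {d} {T : measurableType d} {R : realType} (P : probability T R).

Definition mutually_independent d' (E : measurableType d') (I : finType)
    (X : I -> {RV P >-> E}) :=
  forall (J : {set I}) (A : I -> set E), (forall i, measurable (A i)) ->
  P (\bigcap_(i in [set` J]) (X i @^-1` A i)) =
  (\prod_(i in J) P (X i @^-1` A i))%E.

Definition uniformly_distributed n (X : {RV P >-> 'rV[R]_n})
    (K : set 'rV[R]_n) :=
  forall A, measurable A ->
  distribution P X A =
  (lebesgue_measure_rV n (A `&` K) / lebesgue_measure_rV n K)%E.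

Definition random_polytope n N (X : 'I_N -> {RV P >-> 'rV[R]_n}) (w : T) :
  set 'rV[R]_n := convex_hull (range (fun i => X i w)).

End random_points.

(* Main.v *)
Require Import Defs.
From mathcomp Require Import all_boot all_order all_algebra.
From mathcomp Require Import all_classical all_reals all_analysis.
From mathcomp Require Import measurable_realfun ring lra.

Set Implicit Arguments.
Unset Strict Implicit.
Unset Printing Implicit Defensive.

Import Order.TTheory GRing.Theory Num.Theory.
Import numFieldNormedType.Exports.

Local Open Scope classical_set_scope.
Local Open Scope ring_scope.

(** Only volumes of balls and of explicit cones are needed, because the threshold
    involves [N] on the scale [exp (c n log n)] and factors [exp (O(n))] are
    negligible.

    For few points, the bound holds for every choice of points [y i] of the ball.
    If [x] is in their hull then [dot x x <= dot x (y i)] for some [i], so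
    [|x - y i|^2 <= 1 - |x|^2].  The hull is thus covered by the ball of radius
    [r] and the balls of radius [s] around the points, for all
    [r^2 + s^2 >= 1], and the volume ratio is at most [r^n + N s^n]
    ([lebesgue_measure_convex_hull_le]).  With [1 - r = n^(-1 + eps/2)] both terms
    tend to 0.

    For many points, take a net of unit vectors [u] and, around each, the
    part of the cone of angular radius [rho] lying between the spheres of
    radii [s] and 1.  This region sits in a cap of the ball of height of order
    [(1 - s) + rho^2], and yet has volume ratio at least [(1 - s) (rho / 4)^n]
    ([cone_shell_dot], [cone_shell_volume]).  If each region contains a point, the
    support function of the hull is close to 1 in every direction, and the hull
    contains a ball of radius close to 1 by projection onto its nearest point
    ([convex_hull_supset_eball]).  By independence and the union bound, the
    probability that some region is missed is at most
    [(2 k + 1)^n exp (- (1 - s) (rho / 4)^n N)] ([expected_volume_ratio_ge_net]).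
    With [1 - s = rho^2 = n^(-1 - eps/2)] and a net of [(2 n^2 + 1)^n] directions
    this tends to 0, while the radius of the ball is [1 - O(n^(-1 - eps/2))], so
    that its volume ratio tends to 1.

    The volume of the hull is an arbitrary nonnegative function of the sample, but
    it is only compared with constants, and the integral is monotone on all
    nonnegative functions ([le_lower_integral]). *)

(** * Integrals and Lebesgue measure on arbitrary sets *)

Section lower_integral.
Local Open Scope ereal_scope.

(** The integral of a nonnegative function is a supremum over the simple
    functions below it, so it is monotone even on functions that are not
    measurable.  The volume of a random convex hull, as a function of the sample,
    can thus be compared with constants before integrating. *)
Lemma le_lower_integral d (T : measurableType d) (R : realType)
    (mu : {measure set T -> \bar R}) (f g : T -> \bar R) :
  (forall x, 0 <= f x) -> (forall x, f x <= g x) ->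
  \int[mu]_x f x <= \int[mu]_x g x.
Proof.
move=> f0 fg; have g0 x : 0 <= g x by exact: le_trans (f0 x) (fg x).
rewrite !ge0_integralTE//; apply: le_ereal_sup => _ [h hf <-].
by exists h => //= x; exact: le_trans (hf x) (fg x).
Qed.

(** Off the measurable sets, Lebesgue measure is still an iterated lower
    integral of sections, hence monotone. *)
Lemma le_lebesgue_measure_rV (R : realType) n (A B : set 'rV[R]_n) :
  A `<=` B -> lebesgue_measure_rV n A <= lebesgue_measure_rV n B.
Proof.
elim: n A B => [|n IH] A B AB /=.
  rewrite !diracE lee_fin ler_nat.
  case: (boolP (0%R \in A)) => //; rewrite inE => /AB B0.
  by rewrite mem_set.
rewrite /measure_rV_cons /pushforward /product_measure1.
apply: le_lower_integral => [x|x]; first exact: measure_ge0.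
apply: IH => v; rewrite !xsectionE /=; exact: AB.
Qed.

End lower_integral.

Section affine_images.
Context {R : realType}.
Implicit Types (c : R) (n : nat).

Let mu := @lebesgue_measure R.

(** It suffices to compare both sides on half-open intervals. *)
Lemma lebesgue_measure_affine c (t : R) (A : set R) : 0 < c -> measurable A ->
  (mu A = c%:E * mu ((fun x => c * x + t)%R @^-1` A))%E.
Proof.
move=> c0 mA; pose f : measurableTypeR R -> measurableTypeR R :=
  fun x => (c * x + t)%R.
have mf : measurable_fun setT f.
  apply: measurable_funD => //; exact: measurable_funM.
pose pm : {measure set (measurableTypeR R) -> \bar R} :=
  measure_function_pushforward__canonical__measure_function_Measure
    (@lebesgue_measure R) mf.
pose c' : {nonneg R} := NngNum (ltW c0).
rewrite [LHS](@lebesgue_measure_unique _ (mscale c' pm))//.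
move=> _ [[a b] ab <-].
rewrite [RHS](_ : _ = c%:E * mu (f @^-1` `]a, b]%classic))%E//.
have -> : f @^-1` `]a, b]%classic = `](a - t) / c, (b - t) / c]%classic.
  apply/seteqP; split=> x /=; rewrite !in_itv/= ltr_pdivrMr// ler_pdivlMr//;
  by rewrite /f ltrBlDr lerBrDr mulrC.
rewrite /mu !lebesgue_measure_itv/= !lte_fin ltr_pM2r ?invr_gt0// ltrD2r.
case: ifPn => _; last by rewrite mule0.
rewrite -!EFinD -EFinM; congr (_%:E).
by rewrite -mulrBl mulrCA divff ?gt_eqF// mulr1; ring.
Qed.

Definition boxes n : set (set 'rV[R]_n) :=
  [set B | exists2 A : 'I_n -> set R, (forall i, measurable (A i)) &
           B = [set v : 'rV[R]_n | forall i, A i (v ord0 i)]].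

(** The boxes are closed under intersection, so this presentation of the Borel
    sets is the one needed for the uniqueness of measures. *)
Lemma measurable_boxesE n : @measurable _ 'rV[R]_n = <<s @boxes n >>.
Proof.
apply/seteqP; split; last first.
  apply: smallest_sub; first exact: sigma_algebra_measurable.
  by move=> _ [A mA ->]; exact: measurable_rV_box.
apply: smallest_sub; first exact: smallest_sigma_algebra.
move=> B /=; rewrite -bigcup_seq => -[i _ [A mA <-]].
apply: sub_sigma_algebra; exists (fun j => if j == i then A else setT).
  by move=> j; case: ifP.
rewrite setTI; apply/seteqP; split=> v /= vA.
  by move=> j; case: eqP => // ->.
by have := vA i; rewrite eqxx.
Qed.

Lemma lebesgue_measure_rV_unique n
    (m : {measure set 'rV[R]_n -> \bar R}) :
  (forall A : 'I_n -> set R, (forall i, measurable (A i)) ->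
    (m [set v : 'rV[R]_n | forall i, A i (v ord0 i)] = \prod_(i < n) mu (A i))%E) ->
  forall A, measurable A -> lebesgue_measure_rV n A = m A.
Proof.
move=> mE A mA.
pose I k : set R := `[- k%:R, k%:R]%classic.
pose g k := [set v : 'rV[R]_n | forall i, I k (v ord0 i)].
apply: (measure_unique (@boxes n) g) => //.
- exact: measurable_boxesE.
- move=> _ _ [A1 mA1 ->] [A2 mA2 ->]; exists (fun i => A1 i `&` A2 i).
    by move=> i; exact: measurableI.
  apply/seteqP; split=> v /=; first by move=> [h1 h2] i; split.
  by move=> h; split=> i; have [] := h i.
- by move=> k; exists (fun=> `[- k%:R, k%:R]%classic).
- apply/seteqP; split=> // v _.
  pose M := \sum_i `|v ord0 i|.
  exists (Num.bound M) => //= i.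
  suff : `|v ord0 i| <= (Num.bound M)%:R by rewrite /I/= in_itv/= ler_norml.
  apply: (@le_trans _ _ M).
    by rewrite /M (bigD1 i)//= lerDl sumr_ge0.
  by apply/ltW/archi_boundP/sumr_ge0.
- by move=> _ [A1 mA1 ->]; rewrite mE//; exact: lebesgue_measure_rV_box.
- move=> k; have E : lebesgue_measure_rV n (g k) = (\prod_(i < n) mu (I k))%E.
    by apply: lebesgue_measure_rV_box => i; exact: measurable_itv.
  change (lebesgue_measure_rV n (g k) < +oo)%E; rewrite E.
  rewrite (eq_bigr (fun=> (k%:R - (- k%:R) : R)%:E)); first by rewrite prodEFin ltry.
  move=> i _; rewrite /= /mu /I lebesgue_measure_itv/= lte_fin.
  case: ltP => // k0; congr _%:E.
  by have : (0 : R) <= k%:R by []; lra.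
Qed.

(** Both sides are measures in [A], and on a box the identity follows from the
    one-dimensional one in each coordinate. *)
Lemma lebesgue_measure_rV_affine n c (t : 'rV[R]_n) (A : set 'rV[R]_n) :
  0 < c -> measurable A ->
  (lebesgue_measure_rV n A =
   (c ^+ n)%:E * lebesgue_measure_rV n ((fun v => c *: v + t)%R @^-1` A))%E.
Proof.
move=> c0 mA; pose f (v : 'rV[R]_n) : 'rV[R]_n := c *: v + t.
have mf : measurable_fun setT f.
  apply: measurable_fun_rV => i; under eq_fun do rewrite !mxE.
  apply: measurable_funD => //; apply: measurable_funM => //.
  exact: measurable_rV_coord.
pose pm : {measure set 'rV[R]_n -> \bar R} :=
  measure_function_pushforward__canonical__measure_function_Measure
    (lebesgue_measure_rV n) mf.
have cn0 : 0 <= c ^+ n by rewrite exprn_ge0// ltW.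
rewrite [LHS](@lebesgue_measure_rV_unique n (mscale (NngNum cn0) pm))//.
move=> {mA}A mA.
rewrite [LHS](_ : _ = (c ^+ n)%:E * lebesgue_measure_rV n
  (f @^-1` [set v : 'rV[R]_n | forall i, A i (v ord0 i)]))%E//.
have -> : lebesgue_measure_rV n
    (f @^-1` [set v : 'rV[R]_n | forall i, A i (v ord0 i)]) =
    (\prod_(i < n) mu ((fun x => c * x + t ord0 i)%R @^-1` A i))%E.
  rewrite (_ : f @^-1` _ = [set v : 'rV[R]_n |
      forall i, ((fun x => c * x + t ord0 i) @^-1` A i) (v ord0 i)]); last first.
    by apply/seteqP; split=> v /= h i; have := h i; rewrite !mxE.
  apply: lebesgue_measure_rV_box => i; rewrite -[X in measurable X]setTI.
  have mg : measurable_fun setT (fun x : measurableTypeR R => c * x + t ord0 i).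
    by apply: measurable_funD => //; exact: measurable_funM.
  exact: mg.
rewrite [RHS](eq_bigr (fun i => c%:E *
    lebesgue_measure ((fun x => (c * x + t ord0 i)%R) @^-1` A i))%E); last first.
  by move=> i _; exact: lebesgue_measure_affine.
by rewrite big_split/= prodEFin prodr_const card_ord.
Qed.

End affine_images.

(** * Euclidean geometry of row vectors *)

Section euclidean_geometry.
Context {R : realType} {n : nat}.
Implicit Types (u v w x y : 'rV[R]_n) (c r : R).

Definition dot u v : R := \sum_i u ord0 i * v ord0 i.

Lemma dotC u v : dot u v = dot v u.
Proof. by apply: eq_bigr => i _; rewrite mulrC. Qed.

Lemma dotDl u v w : dot (u + v) w = dot u w + dot v w.
Proof. by rewrite /dot -big_split; apply: eq_bigr => i _; rewrite mxE mulrDl. Qed.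

Lemma dotZl c u v : dot (c *: u) v = c * dot u v.
Proof. by rewrite /dot mulr_sumr; apply: eq_bigr => i _; rewrite mxE mulrA. Qed.

Lemma dotNl u v : dot (- u) v = - dot u v.
Proof. by rewrite -scaleN1r dotZl mulN1r. Qed.

Lemma dotBl u v w : dot (u - v) w = dot u w - dot v w.
Proof. by rewrite dotDl dotNl. Qed.

Lemma dotDr u v w : dot w (u + v) = dot w u + dot w v.
Proof. by rewrite dotC dotDl !(dotC w). Qed.

Lemma dotZr c u v : dot u (c *: v) = c * dot u v.
Proof. by rewrite dotC dotZl dotC. Qed.

Lemma dotNr u v : dot u (- v) = - dot u v.
Proof. by rewrite dotC dotNl dotC. Qed.

Lemma dotBr u v w : dot w (u - v) = dot w u - dot w v.
Proof. by rewrite dotDr dotNr. Qed.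

Definition dotE := (dotDl, dotDr, dotBl, dotBr, dotNl, dotNr, dotZl, dotZr).

Lemma dot_ge0 v : 0 <= dot v v.
Proof. by apply: sumr_ge0 => i _; rewrite -expr2 sqr_ge0. Qed.

Lemma enorm_ge0 v : 0 <= enorm v. Proof. exact: sqrtr_ge0. Qed.
Hint Resolve enorm_ge0 : core.

Lemma sqr_enorm v : enorm v ^+ 2 = dot v v.
Proof.
rewrite /enorm (eq_bigr (fun i => v ord0 i * v ord0 i)) => [|i _].
  by rewrite sqr_sqrtr//; exact: dot_ge0.
by rewrite expr2.
Qed.

Lemma dot_subZ c u v :
  dot (u - c *: v) (u - c *: v) = dot u u - 2 * c * dot v u + c ^+ 2 * dot v v.
Proof. by rewrite !dotE (dotC u v); ring. Qed.

Lemma enorm_le v r : 0 <= r -> (enorm v <= r) = (dot v v <= r ^+ 2).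
Proof. by move=> r0; rewrite -sqr_enorm ler_sqr ?nnegrE. Qed.

Lemma enormZ c v : enorm (c *: v) = `|c| * enorm v.
Proof.
apply/eqP; rewrite -(eqrXn2 (n := 2))// ?mulr_ge0// exprMn !sqr_enorm !dotE.
by rewrite real_normK ?num_real// expr2 mulrA.
Qed.

Lemma enormN v : enorm (- v) = enorm v.
Proof. by rewrite -scaleN1r enormZ normrN normr1 mul1r. Qed.

Lemma enorm_dist u v : enorm (u - v) = enorm (v - u).
Proof. by rewrite -enormN opprB. Qed.

Lemma enorm_eq0 v : enorm v = 0 -> v = 0.
Proof.
move=> v0; have : dot v v = 0 by rewrite -sqr_enorm v0 expr0n.
move/eqP; rewrite psumr_eq0; last by move=> i _; rewrite -expr2 sqr_ge0.
move=> /allP v2; apply/rowP => i; rewrite mxE.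
have := v2 i; rewrite mem_index_enum => /(_ isT)/=.
by rewrite mulf_eq0 orbb => /eqP.
Qed.

Lemma enorm_gt0 v : v != 0 -> 0 < enorm v.
Proof.
move=> v0; rewrite lt_neqAle enorm_ge0 andbT eq_sym.
by apply: contra v0 => /eqP/enorm_eq0->.
Qed.

Lemma coord_le_enorm v i : `|v ord0 i| <= enorm v.
Proof.
rewrite -sqrtr_sqr ler_wsqrtr// (bigD1 i)//= lerDl.
by apply: sumr_ge0 => j _; exact: sqr_ge0.
Qed.

Lemma Cauchy_Schwarz u v : dot u v <= enorm u * enorm v.
Proof.
have [->|u0] := eqVneq u 0.
  by rewrite -(scale0r 0) dotZl mul0r mulr_ge0.
have [->|v0] := eqVneq v 0.
  by rewrite -(scale0r 0) dotZr mul0r mulr_ge0.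
move/enorm_gt0 : u0 => u0; move/enorm_gt0 : v0 => v0.
(* The squared distance between the two normalized vectors is nonnegative. *)
have := dot_ge0 ((enorm u)^-1 *: u - (enorm v)^-1 *: v).
rewrite !dotE (dotC v u) -!sqr_enorm.
set a := enorm u in u0 *; set b := enorm v in v0 *; set d := dot u v.
rewrite [X in 0 <= X -> _](_ : _ = 2 * (1 - d / (a * b))); last first.
  by field; rewrite !gt_eqF.
by rewrite pmulr_rge0// subr_ge0 ler_pdivrMr ?mulr_gt0// mul1r.
Qed.

Lemma enormD u v : enorm (u + v) <= enorm u + enorm v.
Proof.
rewrite enorm_le ?addr_ge0// !dotE (dotC v u) sqrrD !sqr_enorm.
have := Cauchy_Schwarz u v; lra.
Qed.

Lemma enormB u v : enorm u - enorm v <= enorm (u - v).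
Proof. by rewrite lerBlDr (le_trans _ (enormD _ _))// subrK. Qed.

Lemma measurable_enorm : measurable_fun [set: 'rV[R]_n] (@enorm R n).
Proof.
have ms : measurable_fun [set: R] (@Num.sqrt R).
  by apply: continuous_measurable_fun; exact: sqrt_continuous.
apply: (measurableT_comp (f := fun x : R => Num.sqrt x) ms).
apply: measurable_sum => i; apply: measurable_funX.
exact: measurable_rV_coord.
Qed.

Lemma measurable_le_fun (f g : 'rV[R]_n -> R) :
  measurable_fun setT f -> measurable_fun setT g ->
  measurable [set v | f v <= g v].
Proof.
move=> mf mg; rewrite -[X in measurable X]setTI.
exact: measurable_fun_le.
Qed.

Definition eball v r : set 'rV[R]_n := [set w | enorm (w - v) <= r].

Lemma unit_ballE : unit_ball R n = eball 0 1.
Proof. by apply/seteqP; split=> v; rewrite /unit_ball/eball/= subr0. Qed.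

Lemma measurable_eball v r : measurable (eball v r).
Proof.
apply: measurable_le_fun => //.
apply: (measurableT_comp (f := @enorm R n)); first exact: measurable_enorm.
apply: measurable_fun_rV => i; under eq_fun do rewrite mxE.
apply: measurable_funD => //; exact: measurable_rV_coord.
Qed.

Lemma measurable_unit_ball : measurable (unit_ball R n).
Proof. by rewrite unit_ballE; exact: measurable_eball. Qed.

End euclidean_geometry.
#[global] Hint Extern 0 (is_true (0 <= enorm _)) =>
  solve [exact: enorm_ge0] : core.
#[global] Hint Extern 0 (measurable (unit_ball _ _)) =>
  solve [exact: measurable_unit_ball] : core.
#[global] Hint Extern 0 (measurable (eball _ _)) =>
  solve [exact: measurable_eball] : core.

Lemma measure_setU_bigsetU_le d (T : measurableType d) (R : realType)
    (mu : {measure set T -> \bar R}) (I : finType) (A : set T) (F : I -> set T)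
    (a : \bar R) (b : I -> \bar R) :
  measurable A -> (forall i, measurable (F i)) ->
  (mu A <= a)%E -> (forall i, mu (F i) <= b i)%E ->
  (mu (A `|` \big[setU/set0]_i F i) <= a + \sum_i b i)%E.
Proof.
move=> mA mF Aa Fb.
have mUF (s : seq I) : measurable (\big[setU/set0]_(i <- s) F i).
  exact: bigsetU_measurable.
apply: le_trans (measureU2 mu mA (mUF _)) _; apply: leeD => //.
elim: (index_enum I) => [|i s IH]; first by rewrite !big_nil measure0.
rewrite !big_cons; apply: le_trans (measureU2 mu (mF i) (mUF s)) _.
by apply: leeD => //; exact: Fb.
Qed.

(** * Volumes of balls *)

Section ball_volume.
Context {R : realType}.
Implicit Types n : nat.

Lemma lebesgue_measure_eball n (v : 'rV[R]_n) (r : R) : 0 < r ->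
  (lebesgue_measure_rV n (eball v r) =
   (r ^+ n)%:E * lebesgue_measure_rV n (unit_ball R n))%E.
Proof.
move=> r0; rewrite (lebesgue_measure_rV_affine v r0 (measurable_eball v r)).
congr (_ * lebesgue_measure_rV n _)%E; apply/seteqP; split=> w /=;
rewrite /eball /unit_ball /= addrK enormZ gtr0_norm// -{2}(mulr1 r) ler_pM2l//.
Qed.

Lemma unit_ball_fin_num n :
  lebesgue_measure_rV n (unit_ball R n) \is a fin_num.
Proof.
rewrite ge0_fin_numE//; pose I : set R := `[-1, 1]%classic.
apply: (@le_lt_trans _ _ (lebesgue_measure_rV n
    [set v : 'rV[R]_n | forall i, I (v ord0 i)])).
  apply: le_lebesgue_measure_rV => v v1 i.
  suff : `|v ord0 i| <= 1 by rewrite /I/= in_itv/= ler_norml.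
  exact: le_trans (coord_le_enorm v i) v1.
rewrite (lebesgue_measure_rV_box (A := fun=> I)); last first.
  by move=> i; exact: measurable_itv.
rewrite (eq_bigr (fun=> (2 : R)%:E)); first by rewrite prodEFin ltry.
move=> i _; rewrite /I/= lebesgue_measure_itv/= lte_fin ifT; last lra.
by rewrite -EFinD; congr _%:E; lra.
Qed.

(** The ball contains the cube of half-side [1 / (n + 1)]; using [n + 1] rather
    than [n] also covers dimension 0. *)
Lemma unit_ball_gt0 n : (0 < lebesgue_measure_rV n (unit_ball R n))%E.
Proof.
pose a : R := n.+1%:R^-1; pose I : set R := `[- a, a]%classic.
have a0 : 0 < a by rewrite invr_gt0.
apply: (@lt_le_trans _ _ (lebesgue_measure_rV n
    [set v : 'rV[R]_n | forall i, I (v ord0 i)])).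
  rewrite (lebesgue_measure_rV_box (A := fun=> I)); last first.
    by move=> i; exact: measurable_itv.
  rewrite (eq_bigr (fun=> (2 * a)%:E)).
    by rewrite prodEFin lte_fin prodr_gt0// => i _; rewrite mulr_gt0.
  move=> i _; rewrite /I/= lebesgue_measure_itv/= lte_fin ifT; last lra.
  by rewrite -EFinD; congr _%:E; lra.
apply: le_lebesgue_measure_rV => v vI; rewrite /unit_ball/= enorm_le// /dot.
apply: (@le_trans _ _ (\sum_(i < n) a ^+ 2)).
  apply: ler_sum => i _; rewrite -expr2 -real_normK ?num_real// lerXn2r ?nnegrE//.
    exact: ltW.
  by have := vI i; rewrite /I/= in_itv/= ler_norml.
rewrite sumr_const card_ord expr1n -mulr_natr expr2 -mulrA.
apply: mulr_ile1; rewrite ?mulr_ge0 ?(ltW a0)//.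
  by rewrite invf_le1// ler1n.
by rewrite mulrC ler_pdivrMr// mul1r ler_nat.
Qed.

End ball_volume.

(** * Convex hulls of points of the ball have small volume *)

Section convex_hulls.
Context {R : realType} {n : nat}.
Implicit Types (x y u : 'rV[R]_n).

Lemma convex_hull_sub (A B : set 'rV[R]_n) :
  convex_set (B : set (convex_lmodType 'rV[R]_n)) -> A `<=` B ->
  convex_hull A `<=` B.
Proof. exact: smallest_sub. Qed.

Lemma convex_hull_convex (A : set 'rV[R]_n) :
  convex_set (convex_hull A : set (convex_lmodType 'rV[R]_n)).
Proof.
move=> x y l; rewrite !inE => xA yA B [cB AB].
have := cB x y l; rewrite !inE; apply; [exact: xA|exact: yA].
Qed.

Lemma convE x y (l : {i01 R}) :
  @conv R (convex_lmodType 'rV[R]_n) l x y =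
  l%:num *: x + (1 - l%:num) *: y.
Proof. by []. Qed.

Lemma convex_halfspace u (c : R) :
  convex_set ([set y | dot u y < c] : set (convex_lmodType 'rV[R]_n)).
Proof.
move=> x y l; rewrite !inE/= convE => xc yc; rewrite !dotE.
have l0 : 0 <= l%:num by []. have l1 : l%:num <= 1 by [].
move: (l%:num) l0 l1 => t; rewrite le_eqVlt => /orP[/eqP<-|t0 t1]; first lra.
nra.
Qed.

Lemma convex_eball (r : R) :
  convex_set (eball 0 r : set (convex_lmodType 'rV[R]_n)).
Proof.
move=> x y l; rewrite !inE/= convE /eball/= !subr0 => xr yr.
have l0 : 0 <= l%:num by []. have l1 : l%:num <= 1 by [].
rewrite (le_trans (enormD _ _))// !enormZ !ger0_norm ?subr_ge0//.
move: (l%:num) l0 l1 => t ? ?; nra.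
Qed.

Lemma convex_hull_dot (A : set 'rV[R]_n) x u :
  convex_hull A x -> exists2 y, A y & dot u x <= dot u y.
Proof.
move=> Ax; apply: contrapT => h.
suff : dot u x < dot u x by rewrite ltxx.
apply: (convex_hull_sub (@convex_halfspace u (dot u x)) _ Ax) => y Ay /=.
by rewrite ltNge; apply/negP => uxy; apply: h; exists y.
Qed.

(** If [x] is in the hull, the linear form [dot x] is at least [dot x x] at
    some vertex [y i], that is, [x] lies in the ball with diameter [[0, y i]].
    Then [|x - y i|^2 <= |y i|^2 - |x|^2], so a point of the hull which is far
    from the origin is close to a vertex. *)
Lemma convex_hull_sub_balls N (y : 'I_N -> 'rV[R]_n) (r s : R) :
  (forall i, enorm (y i) <= 1) -> 0 <= r -> 0 <= s -> 1 <= r ^+ 2 + s ^+ 2 ->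
  convex_hull (range y) `<=` eball 0 r `|` \big[setU/set0]_i eball (y i) s.
Proof.
move=> y1 r0 s0 rs x xA; have [xr|rx] := leP (enorm x) r.
  by left; rewrite /eball/= subr0.
right; rewrite -bigcup_seq/=.
have [_ [i _ <-] xxy] := convex_hull_dot x xA.
exists i; first by rewrite /= mem_index_enum.
rewrite /eball/= enorm_le// !dotE (dotC (y i) x).
have : dot (y i) (y i) <= 1 ^+ 2 by rewrite -enorm_le //; exact: y1.
have : r ^+ 2 <= dot x x.
  by rewrite -sqr_enorm ler_sqr ?nnegrE ?enorm_ge0 ?(ltW rx).
lra.
Qed.

(** There is a trade-off between the two terms: [r ^+ n] is small only if
    [1 - r] is large compared with [1 / n], and as [s^2] is about [2 (1 - r)] the
    factor [s ^+ n] is then slightly larger than [n^(- n / 2)]. *)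
Lemma lebesgue_measure_convex_hull_le N (y : 'I_N -> 'rV[R]_n) (r s : R) :
  (forall i, enorm (y i) <= 1) -> 0 < r -> 0 < s -> 1 <= r ^+ 2 + s ^+ 2 ->
  (lebesgue_measure_rV n (convex_hull (range y)) <=
   (r ^+ n + N%:R * s ^+ n)%:E * lebesgue_measure_rV n (unit_ball R n))%E.
Proof.
move=> y1 r0 s0 rs.
apply: le_trans (le_lebesgue_measure_rV
  (convex_hull_sub_balls y1 (ltW r0) (ltW s0) rs)) _.
pose mu : {measure set 'rV[R]_n -> \bar R} := lebesgue_measure_rV n.
set V := lebesgue_measure_rV n (unit_ball R n).
have Vfin : V \is a fin_num := @unit_ball_fin_num R n.
have muE v t : 0 < t -> (mu (eball v t) <= (t ^+ n * fine V)%:E)%E.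
  by move=> t0; rewrite EFinM fineK// /mu/= lebesgue_measure_eball.
apply: le_trans (measure_setU_bigsetU_le (mu := mu) (I := 'I_N)
  (measurable_eball 0 r) (fun i => measurable_eball (y i) s)
  (muE 0 r r0) (fun i => muE (y i) s s0)) _.
rewrite -[in leRHS](fineK Vfin) -EFinM mulrDl EFinD leeD//.
by rewrite sumEFin sumr_const card_ord -mulrA mulr_natl.
Qed.

End convex_hulls.

(** * Caps of the ball and the cones inside them *)

Section cones.
Context {R : realType} {n : nat}.
Implicit Types (u y : 'rV[R]_n) (s rho : R).

(** The points of the unit ball whose direction is within [rho] of [u], written
    without dividing by the norm. *)
Definition full_cone u rho : set 'rV[R]_n :=
  [set y | enorm y <= 1 /\ enorm (y - enorm y *: u) <= rho * enorm y].

Definition cone_shell u s rho : set 'rV[R]_n :=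
  full_cone u rho `&` [set y | s <= enorm y].

Lemma measurable_full_cone u rho : measurable (full_cone u rho).
Proof.
have mN := @measurable_enorm R n.
apply: measurableI; apply: measurable_le_fun => //.
  apply: (measurableT_comp mN); apply: measurable_fun_rV => i.
  under eq_fun do rewrite !mxE.
  apply: measurable_funB; first exact: measurable_rV_coord.
  exact: measurable_funM.
exact: measurable_funM.
Qed.

Lemma measurable_cone_shell u s rho : measurable (cone_shell u s rho).
Proof.
apply: measurableI; first exact: measurable_full_cone.
by apply: measurable_le_fun => //; exact: measurable_enorm.
Qed.

(** The small ball is internally tangent to the unit sphere at [u], and so lies
    both in the unit ball and in the cone. *)
Lemma full_cone_ball u rho : enorm u = 1 -> 0 < rho <= 1 ->
  eball ((1 - rho / 4) *: u) (rho / 4) `<=` full_cone u rho.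
Proof.
move=> u1 /andP[r0 r1] y; rewrite /eball/= => yu.
set c := 1 - rho / 4 in yu *.
have c0 : 0 < c by rewrite /c; lra.
have Ec : enorm (c *: u) = c by rewrite enormZ u1 mulr1 gtr0_norm.
have := enormB y (c *: u); have := enormB (c *: u) y; rewrite Ec enorm_dist => h1 h2.
have yl : 1 - rho / 2 <= enorm y by rewrite /c in h1 *; lra.
split; first by rewrite /c in h2; lra.
have -> : y - enorm y *: u = (y - c *: u) + (c - enorm y) *: u.
  by rewrite [(c - _) *: u]scalerBl addrA subrK.
apply: le_trans (enormD _ _) _; rewrite enormZ u1 mulr1.
have : `|c - enorm y| <= rho / 4 by rewrite ler_norml; apply/andP; split; lra.
have : rho * (1 - rho / 2) <= rho * enorm y by rewrite ler_pM2l.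
nra.
Qed.

(** A cone shell of angular radius [rho] lies in a cap of height of order
    [(1 - s) + rho^2]: the square is why caps of height [a] have a volume ratio
    of order [a^(n/2)], up to a factor [exp (O(n))]. *)
Lemma cone_shell_dot u s rho y : enorm u = 1 -> 0 < s -> rho ^+ 2 <= 2 ->
  cone_shell u s rho y -> s * (1 - rho ^+ 2 / 2) <= dot y u.
Proof.
move=> u1 s0 rho2 [[y1 yu]] /= sy.
have y0 : 0 < enorm y by exact: lt_le_trans sy.
have : dot (y - enorm y *: u) (y - enorm y *: u) <= rho ^+ 2 * enorm y ^+ 2.
  rewrite -sqr_enorm -exprMn ler_sqr ?nnegrE//.
  exact: le_trans (enorm_ge0 _) yu.
rewrite !dotE (dotC u y) -!sqr_enorm u1.
move: (enorm y) (dot y u) (rho ^+ 2) y0 sy rho2 => a d q a0 sa q2 h.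
have : a * (a * (1 - q / 2)) <= a * d by nra.
rewrite ler_pM2l// => /(le_trans _); apply.
by apply: ler_wpM2r => //; lra.
Qed.

(** The part of the cone inside the ball of radius [s] is a copy of the whole
    cone scaled by [s], so the shell keeps the proportion [1 - s^n >= 1 - s] of
    the cone, which in turn contains a ball of radius [rho / 4]. *)
Lemma cone_shell_volume u s rho : (0 < n)%N -> enorm u = 1 -> 0 < s < 1 ->
  0 < rho <= 1 ->
  (((1 - s) * (rho / 4) ^+ n)%:E * lebesgue_measure_rV n (unit_ball R n) <=
   lebesgue_measure_rV n (cone_shell u s rho))%E.
Proof.
move=> n0 u1 /andP[s0 s1] rho01; have /andP[rho0 rho1] := rho01.
pose mu := @lebesgue_measure_rV R n.
set K := full_cone u rho; set S := cone_shell u s rho.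
have mK : measurable K by exact: measurable_full_cone.
have mS : measurable S by exact: measurable_cone_shell.
pose sK := full_cone u rho `&` [set y | enorm y <= s].
have msK : measurable sK.
  by apply: measurableI => //; apply: measurable_le_fun => //; exact: measurable_enorm.
have KE : K `<=` S `|` sK.
  move=> y Ky; have [ys|sy] := leP s (enorm y); [left|right]; split => //.
  exact: ltW.
have Kfin : mu K \is a fin_num.
  rewrite ge0_fin_numE//; apply: le_lt_trans (_ : _ <= mu (unit_ball R n))%E _.
    by apply: le_lebesgue_measure_rV => y [].
  by rewrite -ge0_fin_numE// unit_ball_fin_num.
have Sfin : mu S \is a fin_num.
  rewrite ge0_fin_numE//; apply: le_lt_trans (_ : _ <= mu K)%E _.
    by apply: le_lebesgue_measure_rV => y [].
  by rewrite -ge0_fin_numE.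
have sKE : (mu sK = (s ^+ n)%:E * mu K)%E.
  rewrite /mu (lebesgue_measure_rV_affine 0 s0 msK); congr (_ * mu _)%E.
  apply/seteqP; split=> y; rewrite /sK /K /full_cone /= addr0 enormZ gtr0_norm//.
    move=> [[_ h1] h2]; split; first by rewrite -(ler_pM2l s0) mulr1.
    by move: h1; rewrite -scalerA -scalerBr enormZ gtr0_norm// mulrCA ler_pM2l.
  move=> [y1 yu]; have sy : s * enorm y <= s by rewrite -[leRHS]mulr1 ler_pM2l.
  split=> //; split; first by lra.
  by rewrite -scalerA -scalerBr enormZ gtr0_norm// mulrCA ler_pM2l.
have : (mu K <= mu S + mu sK)%E.
  apply: le_trans (le_lebesgue_measure_rV KE) _; exact: measureU2.
have : (((rho / 4) ^+ n)%:E * mu (unit_ball R n) <= mu K)%E.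
  rewrite -(lebesgue_measure_eball ((1 - rho / 4) *: u)) ?divr_gt0//.
  exact/le_lebesgue_measure_rV/full_cone_ball.
rewrite sKE -/mu -(fineK (unit_ball_fin_num n)) -/mu -(fineK Kfin) -(fineK Sfin).
rewrite -!EFinM -EFinD !lee_fin.
set V := fine (mu (unit_ball R n)); set k := fine (mu K); set q := _ ^+ n.
have sn : s ^+ n <= s.
  by case: (n) n0 => // m _; rewrite exprS ger_pMr// exprn_ile1 // ltW.
move=> h1 h2; have : (1 - s) * (q * V) <= (1 - s) * k by rewrite ler_pM2l ?subr_gt0.
have : s ^+ n * k <= s * k by rewrite ler_wpM2r// fine_ge0.
lra.
Qed.

End cones.

(** * Convex hulls meeting every cap contain a ball *)

Section barycenters.
Context {R : realType} {n : nat}.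

(** Dividing by the total weight, instead of assuming that it is 1, is what makes
    the induction on the number of points go through. *)
Lemma convex_set_barycenter (B : set 'rV[R]_n) (I : eqType) (s : seq I)
    (t : I -> R) (y : I -> 'rV[R]_n) :
  convex_set (B : set (convex_lmodType 'rV[R]_n)) ->
  (forall i, 0 <= t i) -> (forall i, B (y i)) -> 0 < \sum_(i <- s) t i ->
  B ((\sum_(i <- s) t i)^-1 *: \sum_(i <- s) t i *: y i).
Proof.
move=> cB t0 By; elim: s => [|i s IH]; first by rewrite big_nil ltxx.
rewrite !big_cons; set S := \sum_(j <- s) t j in IH *.
have : 0 <= S by exact: sumr_ge0.
rewrite le_eqVlt => /orP[/eqP S0|S0] St.
  have -> : \sum_(j <- s) t j *: y j = 0.
    rewrite big_seq big1// => j js; suff -> : t j = 0 by rewrite scale0r.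
    move/esym/eqP : S0; rewrite psumr_eq0// => /allP/(_ j js).
    by move/eqP.
  rewrite -S0 !addr0 in St *.
  by rewrite scalerA mulVf ?gt_eqF// scale1r.
have l0 : 0 <= t i / (t i + S) by rewrite divr_ge0// ltW.
have l1 : t i / (t i + S) <= 1 by rewrite ler_pdivrMr// mul1r lerDl ltW.
have := cB (y i) (S^-1 *: \sum_(j <- s) t j *: y j) (Itv01 l0 l1).
rewrite !inE => /(_ (By i) (IH S0)); rewrite convE/=.
congr (B _); rewrite scalerDr !scalerA; congr (_ *: _ + _ *: _).
  by rewrite mulrC.
by field; rewrite !gt_eqF.
Qed.

Lemma convex_hull_barycenter N (y : 'I_N -> 'rV[R]_n) (t : 'rV[R]_N) :
  (forall i, 0 <= t ord0 i) -> \sum_i t ord0 i = 1 ->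
  convex_hull (range y) (\sum_i t ord0 i *: y i).
Proof.
move=> t0 t1; have yh i : convex_hull (range y) (y i).
  by apply: sub_gen_smallest; exists i.
have := convex_set_barycenter (s := index_enum 'I_N)
  (@convex_hull_convex R n (range y)) t0 yh.
by rewrite t1 invr1 scale1r; apply.
Qed.

End barycenters.

Section nearest_point.
Context {R : realType} {n N : nat}.
Variable y : 'I_N -> 'rV[R]_n.

Definition simplex : set 'rV[R]_N :=
  [set t | (forall i, 0 <= t ord0 i) /\ \sum_i t ord0 i = 1].

Let comb (t : 'rV[R]_N) : 'rV[R]_n := \sum_i t ord0 i *: y i.

Lemma continuous_sumR (T : topologicalType) (I : Type) (s : seq I)
    (f : I -> T -> R) :
  (forall i, continuous (f i)) -> continuous (fun x => \sum_(i <- s) f i x).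
Proof.
by move=> cf; apply: continuous_big => //; exact: add_continuous.
Qed.

Lemma compact_simplex : compact simplex.
Proof.
apply: bounded_closed_compact.
  exists 1; split=> // M M1 t [t0 t1] /=.
  rewrite [leLHS]/Num.norm/= mx_normrE; apply: bigmax_le; first lra.
  move=> -[i j] _ /=; rewrite ord1 ger0_norm//.
  apply: le_trans (ltW M1).
  by rewrite -t1 (bigD1 j)//= lerDl sumr_ge0.
rewrite (_ : simplex = (\bigcap_i (fun t : 'rV[R]_N => t ord0 i) @^-1` [set x | 0 <= x])
   `&` (fun t : 'rV[R]_N => \sum_i t ord0 i) @^-1` [set x | x = 1]); last first.
  by apply/seteqP; split=> t [h1 h2]; split=> //= i; [move=> _; exact: h1|exact: h1].
apply: closedI.
  apply: closed_bigI => i _; apply: preimage_closed; last exact: closed_ge.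
  by move=> t _; exact: coord_continuous.
apply: preimage_closed; last exact: closed_eq.
by move=> t _; apply: continuous_sumR => i; exact: coord_continuous.
Qed.

(** The squared distance to [x] has a minimum on the hull, which is the image of
    a compact simplex.  At the minimizer [p], moving a little towards a vertex
    cannot decrease the distance, which is the variational inequality. *)
Lemma nearest_point (x : 'rV[R]_n) : (0 < N)%N ->
  exists2 p, convex_hull (range y) p & forall i, dot (y i - p) (x - p) <= 0.
Proof.
move=> N0; pose i0 := Ordinal N0; pose f t := dot (x - comb t) (x - comb t).
have cf : continuous f.
  apply: continuous_sumR => j.
  have cj : continuous (fun t => (x - comb t) ord0 j).
    have -> : (fun t => (x - comb t) ord0 j) =
        (fun t => x ord0 j - \sum_i t ord0 i * y i ord0 j).
      apply/funext => t; rewrite !mxE summxE; congr (_ - _).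
      by apply: eq_bigr => i _; rewrite mxE.
    move=> t; apply: continuousB; first exact: cst_continuous.
    apply: continuous_sumR => i {}t; apply: continuousM; last exact: cst_continuous.
    exact: coord_continuous.
  by move=> t; apply: continuousM; exact: cj.
have S0 : simplex !=set0.
  exists (delta_mx ord0 i0); split=> [i|].
    by rewrite mxE ler0n.
  rewrite (bigD1 i0)//= big1 ?addr0 ?mxE ?eqxx// => i ii0.
  by rewrite mxE (negbTE ii0) andbF.
have [c] := EVT_min_rV S0 compact_simplex (continuous_subspaceT cf).
rewrite inE => -[c0 c1] cmin; exists (comb c).
  exact: convex_hull_barycenter.
move=> i; set p := comb c; set A := dot _ _.
rewrite leNgt; apply/negP => A0.
pose B := dot (y i - p) (y i - p).
have B0 : 0 <= B by exact: dot_ge0.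
(* Minimality of [p] against the point [p + tau * (y i - p)]. *)
have key (tau : R) : 0 < tau <= 1 -> 2 * A <= tau * B.
  move=> /andP[tau0 tau1].
  pose t : 'rV[R]_N := (1 - tau) *: c + tau *: delta_mx ord0 i.
  have tS : simplex t.
    split=> [j|].
      by rewrite !mxE addr_ge0// mulr_ge0// ?subr_ge0// ltW.
    under eq_bigr do rewrite !mxE.
    rewrite big_split/= -!mulr_sumr c1.
    rewrite [X in tau * X](bigD1 i)//= big1 ?eqxx/=; first lra.
    by move=> j /negbTE ->; rewrite ?andbF ?mulr0n.
  have tE : x - comb t = (x - p) - tau *: (y i - p).
    have -> : comb t = (1 - tau) *: p + tau *: y i.
      have -> : tau *: y i = \sum_j (tau * (j == i)%:R) *: y j.
        rewrite (bigD1 i)//= big1 ?addr0 ?eqxx ?mulr1// => j /negbTE ->.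
        by rewrite mulr0 scale0r.
      rewrite /p /comb scaler_sumr -big_split/=; apply: eq_bigr => j _.
      by rewrite !mxE eqxx/= scalerA -scalerDl.
    by apply/rowP => j; rewrite !mxE; ring.
  have := cmin t; rewrite inE => /(_ tS); rewrite /f -/p tE.
  rewrite dot_subZ -/A -/B; move: (dot _ _) => D.
  have : 0 < tau^-1 by rewrite invr_gt0. nra.
(* The optimal step is [A / B], truncated at 1. *)
have [AB|BA] := leP B A.
  by have := key 1; rewrite ltr01 lexx => /(_ isT); lra.
have B1 : 0 < B by exact: lt_trans BA.
have := key (A / B); rewrite divr_gt0//= ler_pdivrMr// mul1r ltW// => /(_ isT).
by rewrite divfK ?gt_eqF//; lra.
Qed.

(** If [x] is not in the hull, the unit vector [v] from its nearest point [p] to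
    [x] satisfies [dot (y i) v <= dot p v < dot x v <= r] for all [i]. *)
Lemma convex_hull_supset_eball (r : R) : (0 < N)%N ->
  (forall v : 'rV[R]_n, enorm v = 1 -> exists i, r <= dot (y i) v) ->
  eball 0 r `<=` convex_hull (range y).
Proof.
move=> N0 yr x; rewrite /eball/= subr0 => xr.
have [p ph pmin] := nearest_point x N0.
have [xp|/enorm_gt0] := eqVneq (x - p) 0.
  by move/eqP : xp; rewrite subr_eq0 => /eqP ->.
set a := enorm (x - p) => a0.
have [|i] := yr (a^-1 *: (x - p)).
  by rewrite enormZ gtr0_norm ?invr_gt0// mulVf// gt_eqF.
rewrite dotZr ler_pdivlMl// => ryi; exfalso.
have := pmin i; have := Cauchy_Schwarz x (x - p); rewrite -/a.
have : a ^+ 2 = dot (x - p) (x - p) by rewrite sqr_enorm.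
rewrite [dot (x - p) _]dotBl [dot (y i - p) _]dotBl.
have : enorm x * a <= r * a by rewrite ler_wpM2r// ltW.
nra.
Qed.

End nearest_point.

Section sphere_net.
Context {R : realType} {n : nat}.

(** Cut the cube [[-1, 1]^n] into [(2k + 1)^n] grid cells of side [1 / k] and
    choose one unit vector in each cell that meets the sphere; two vectors of
    the same cell are at distance at most [sqrt n / k]. *)
Lemma sphere_net (k : nat) (delta : R) : (0 < n)%N -> (0 < k)%N -> 0 <= delta ->
  n%:R <= (k%:R * delta) ^+ 2 ->
  exists U : {ffun 'I_n -> 'I_(2 * k).+1} -> 'rV[R]_n,
    (forall f, enorm (U f) = 1) /\
    forall v, enorm v = 1 -> exists f, enorm (v - U f) <= delta.
Proof.
move=> n0 k0 d0 nkd.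
have k0R : (0 : R) < k%:R by rewrite ltr0n.
pose c (v : 'rV[R]_n) i : R := k%:R * (v ord0 i + 1).
pose cell v : {ffun 'I_n -> 'I_(2 * k).+1} := [ffun i => inord (Num.truncn (c v i))].
(* The representative of the cells that miss the sphere. *)
pose e : 'rV[R]_n := delta_mx ord0 (Ordinal n0).
have e1 : enorm e = 1.
  rewrite /enorm (bigD1 (Ordinal n0))//= big1 ?addr0 ?mxE ?eqxx ?expr1n ?sqrtr1//.
  by move=> i /negbTE ie; rewrite mxE ie andbF expr0n.
pose U f := xget e [set v | enorm v = 1 /\ cell v = f].
have U1 f : enorm (U f) = 1 by rewrite /U; case: xgetP => [v -> []|].
exists U; split=> // v v1; exists (cell v).
have [u1 uv] : enorm (U (cell v)) = 1 /\ cell (U (cell v)) = cell v.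
  by apply: (@xgetPex _ e [set w | enorm w = 1 /\ cell w = cell v]); exists v.
set u := U _ in u1 uv *.
have cP (w : 'rV[R]_n) i : enorm w = 1 ->
    ((Num.truncn (c w i))%:R <= c w i < (Num.truncn (c w i)).+1%:R) /\
    (Num.truncn (c w i) <= 2 * k)%N.
  move=> w1; have := coord_le_enorm w i; rewrite w1 ler_norml => /andP[w0 {}w1].
  have cw0 : 0 <= c w i by rewrite mulr_ge0 ?(ltW k0R)//; lra.
  have tr := truncn_itv cw0; split=> //.
  rewrite -(ler_nat R) (le_trans (proj1 (andP tr)))// /c natrM mulrC.
  rewrite ler_wpM2r ?(ltW k0R)//.
  lra.
rewrite enorm_le//; apply: (@le_trans _ _ (\sum_(i < n) (k%:R^-1) ^+ 2)); last first.
  rewrite sumr_const card_ord -[leLHS]mulr_natl exprVn ler_pdivrMr ?exprn_gt0//.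
  by rewrite -exprMn mulrC.
apply: ler_sum => i _; rewrite -expr2 -real_normK ?num_real//.
rewrite ler_sqr ?nnegrE ?invr_ge0 ?(ltW k0R)// !mxE.
have [/andP[a1 a2] a3] := cP v i v1; have [/andP[b1 b2] b3] := cP u i u1.
have tE : Num.truncn (c v i) = Num.truncn (c u i).
  by move/ffunP/(_ i)/(congr1 val) : uv; rewrite !ffunE/= !inordK.
rewrite -tE in b1 b2; rewrite -[leRHS]mul1r ler_pdivlMr//.
rewrite -[X in _ * X]gtr0_norm// -normrM ler_norml; move: a1 a2 b1 b2.
rewrite /c -natr1; move: (_%:R) => t; lra.
Qed.

(** It is enough to hit the cones around the directions of a net: replacing a
    direction by its neighbour in the net costs [delta] in the support
    function, as all the points are in the unit ball. *)
Lemma cone_shells_hit_supset_eball (I : Type) (U : I -> 'rV[R]_n)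
    (delta s rho : R) N (y : 'I_N -> 'rV[R]_n) :
  (0 < N)%N -> 0 < s -> rho ^+ 2 <= 2 ->
  (forall f, enorm (U f) = 1) ->
  (forall v, enorm v = 1 -> exists f, enorm (v - U f) <= delta) ->
  (forall f, exists i, cone_shell (U f) s rho (y i)) ->
  eball 0 (s * (1 - rho ^+ 2 / 2) - delta) `<=` convex_hull (range y).
Proof.
move=> N0 s0 rho2 U1 net hit; apply: convex_hull_supset_eball => // v v1.
have [f vf] := net v v1; have [i yi] := hit f; exists i.
have := cone_shell_dot (U1 f) s0 rho2 yi.
have := Cauchy_Schwarz (y i) (U f - v); rewrite dotBr enorm_dist.
have : enorm (y i) * enorm (v - U f) <= 1 * delta.
  by apply: ler_pM => //; case: yi => -[].
lra.
Qed.

End sphere_net.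

(** * Expected volume in a fixed dimension *)

Section nonmeasurable_expectation.
Context d (T : measurableType d) (R : realType) (P : probability T R).
Implicit Types (g : T -> R) (A : set T) (c : R).

(** Although [g] need not be measurable, it lies below the measurable function
    equal to [c] plus infinity on the null set [A]. *)
Lemma expectation_le_ae g A c : (forall w, 0 <= g w) -> 0 <= c ->
  measurable A -> P A = 0%E -> (forall w, ~ A w -> g w <= c) ->
  ('E_P[g] <= c%:E)%E.
Proof.
move=> g0 c0 mA PA gc; rewrite unlock.
have yA0 w : (0 <= ((cst +oo%E) \_ A) w :> \bar R)%E.
  by rewrite patchE; case: ifP => // _; rewrite leey.
apply: (@le_trans _ _ (\int[P]_w (((cst +oo%E) \_ A) w + cst c%:E w))%E).
  apply: le_lower_integral => w; first by rewrite lee_fin.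
  rewrite patchE; case: ifPn => [_|]; first by rewrite /cst addye// leey.
  by rewrite notin_setE add0e lee_fin => /gc.
rewrite ge0_integralD//; last by apply/(measurable_restrictT _ mA).
have yA : (\int[P]_(w in A) cst +oo w = 0)%E.
  rewrite integral_cst//; apply/eqP; rewrite mule_eq0; apply/orP; right.
  exact/eqP.
have cT : (\int[P]_w cst c%:E w = c%:E)%E.
  rewrite integral_cst// -[RHS]mule1; congr (_ * _)%E; exact: probability_setT.
by rewrite -integral_mkcond yA add0e cT.
Qed.

Lemma expectation_ge_event g A c : (forall w, 0 <= g w) -> 0 <= c ->
  measurable A -> (forall w, A w -> c <= g w) ->
  (c%:E * P A <= 'E_P[g])%E.
Proof.
move=> g0 c0 mA gc; rewrite unlock -integral_cst// integral_mkcond.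
apply: le_lower_integral => w; rewrite patchE; case: ifPn => //= wA.
  by rewrite lee_fin; apply: gc; rewrite inE in wA.
by rewrite lee_fin.
Qed.

End nonmeasurable_expectation.

Section random_points_in_the_ball.
Context d (T : measurableType d) (R : realType) (P : probability T R).
Context (n N : nat) (X : 'I_N -> {RV P >-> 'rV[R]_n}).
Hypothesis X_indep : mutually_independent X.
Hypothesis X_unif : forall i, uniformly_distributed (X i) (unit_ball R n).

Let V : \bar R := lebesgue_measure_rV n (unit_ball R n).
Let Vfin : V \is a fin_num := @unit_ball_fin_num R n.
Let V0 : (0 < V)%E := @unit_ball_gt0 R n.

Definition expected_volume_ratio : \bar R :=
  ('E_P[fun w => fine (lebesgue_measure_rV n (random_polytope X w))] /
   lebesgue_measure_rV n (unit_ball R n))%E.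

Let v := fine V.
Let v0 : 0 < v. Proof. by rewrite fine_gt0// V0 -ge0_fin_numE ?Vfin// ltW. Qed.
Let VE : V = v%:E. Proof. by rewrite fineK. Qed.

Let measurable_RV i A : measurable A -> measurable (X i @^-1` A).
Proof. by move=> mA; exact: measurable_funPTI. Qed.

Let outside_ball := \big[setU/set0]_i X i @^-1` (~` unit_ball R n).

Let P_outside_ball : P outside_ball = 0%E.
Proof.
have mO i : measurable (X i @^-1` (~` unit_ball R n)).
  by apply: measurable_RV; exact: measurableC.
apply/eqP; rewrite eq_le measure_ge0 andbT.
rewrite -[outside_ball]set0U.
apply: le_trans (measure_setU_bigsetU_le (mu := P) (a := 0%E) (b := fun=> 0%E)
  measurable0 mO _ _) _; last by rewrite big1// adde0.
  by rewrite measure0.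
move=> i; have := X_unif i (measurableC (@measurable_unit_ball R n)).
rewrite /distribution /pushforward setICl measure0 mul0e => PO.
by change (P (X i @^-1` (~` unit_ball R n)) <= 0)%E; rewrite PO.
Qed.

Lemma expected_volume_ratio_ge0 : (0 <= expected_volume_ratio)%E.
Proof.
rewrite mule_ge0 ?inve_ge0 ?(ltW V0)//.
by rewrite expectation_ge0// => w; rewrite fine_ge0.
Qed.

Lemma expected_volume_ratio_le (c : R) : 0 <= c ->
  (forall y : 'I_N -> 'rV[R]_n, (forall i, enorm (y i) <= 1) ->
    (lebesgue_measure_rV n (convex_hull (range y)) <= c%:E * V)%E) ->
  (expected_volume_ratio <= c%:E)%E.
Proof.
move=> c0 hull_le; rewrite /expected_volume_ratio -/V VE inver gt_eqF//.
rewrite lee_pdivrMr//.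
apply: (expectation_le_ae _ _ _ P_outside_ball) => //.
- by move=> w; rewrite fine_ge0.
- by rewrite mulr_ge0// ltW.
- apply: bigsetU_measurable => i _; apply: measurable_RV; exact: measurableC.
move=> w wB; rewrite -lee_fin.
have : (lebesgue_measure_rV n (random_polytope X w) <= c%:E * V)%E.
  apply: hull_le => i; apply: contrapT => Xi; apply: wB.
  by rewrite /outside_ball -bigcup_seq; exists i => //=; rewrite mem_index_enum.
rewrite VE -EFinM => h; rewrite fineK// ge0_fin_numE//.
by rewrite (le_lt_trans h)// ltry.
Qed.

(** Almost surely all the points are in the ball, hence so is their hull. *)
Lemma expected_volume_ratio_le1 : (expected_volume_ratio <= 1)%E.
Proof.
apply: expected_volume_ratio_le => // y y1; rewrite mul1e.
apply: le_lebesgue_measure_rV; rewrite unit_ballE.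
apply: convex_hull_sub; first exact: convex_eball.
by move=> _ [i _ <-]; rewrite /eball/= subr0.
Qed.

Lemma expected_volume_ratio_le_shell (r s : R) :
  0 < r -> 0 < s -> 1 <= r ^+ 2 + s ^+ 2 ->
  (expected_volume_ratio <= (r ^+ n + N%:R * s ^+ n)%:E)%E.
Proof.
move=> r0 s0 rs; apply: expected_volume_ratio_le => [|y y1].
  by rewrite addr_ge0 ?mulr_ge0 ?exprn_ge0// ltW.
exact: lebesgue_measure_convex_hull_le.
Qed.

Lemma expected_volume_ratio_ge (A : set T) (r : R) : measurable A -> 0 < r ->
  (forall w, A w -> eball 0 r `<=` random_polytope X w) ->
  ((r ^+ n)%:E * P A <= expected_volume_ratio)%E.
Proof.
move=> mA r0 Ar; rewrite /expected_volume_ratio -/V VE inver gt_eqF//.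
rewrite lee_pdivlMr//.
have -> : ((r ^+ n)%:E * P A * v%:E = (r ^+ n * v)%:E * P A)%E.
  by rewrite EFinM -!muleA; congr (_ * _)%E; rewrite muleC.
apply: expectation_ge_event => //.
- by move=> w; rewrite fine_ge0.
- by rewrite mulr_ge0 ?exprn_ge0 ?ltW.
move=> w /Ar hw; pose M := \sum_i enorm (X i w) + 1.
(* The hull is bounded, so that [fine] does not collapse its volume to 0. *)
have hM : random_polytope X w `<=` eball 0 M.
  apply: convex_hull_sub; first exact: convex_eball.
  move=> _ [i _ <-]; rewrite /eball/= subr0 /M (bigD1 i)//= -addrA lerDl.
  by rewrite addr_ge0// sumr_ge0.
have M0 : 0 < M by rewrite ltr_wpDl// sumr_ge0.
rewrite -lee_fin EFinM -VE fineK; last first.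
  rewrite ge0_fin_numE//.
  apply: (@le_lt_trans _ _ (lebesgue_measure_rV n (eball 0 M))).
    exact: le_lebesgue_measure_rV.
  by rewrite lebesgue_measure_eball// -/V VE -EFinM ltry.
by rewrite /V -(lebesgue_measure_eball 0 r0) le_lebesgue_measure_rV.
Qed.

(** By independence the probability is at most [(1 - p)^N <= exp (- p N)]. *)
Lemma prob_miss (C : set 'rV[R]_n) (p : R) : measurable C ->
  C `<=` unit_ball R n ->
  (p%:E * V <= lebesgue_measure_rV n C)%E ->
  (P (\bigcap_i (X i @^-1` (~` C))) <= (expR (- (p * N%:R)))%:E)%E.
Proof.
move=> mC CB pC.
have := X_indep finset.setT (A := fun=> ~` C) (fun=> measurableC mC).
rewrite (_ : [set` _] = setT) => [->|]; last first.
  by apply/seteqP; split => // i _ /=; rewrite finset.in_setT.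
have PC i : (P (X i @^-1` (~` C)) <= (expR (- p))%:E)%E.
  have := X_unif i mC; rewrite /distribution /pushforward setIidl// => PXC.
  have -> : X i @^-1` (~` C) = ~` (X i @^-1` C) by [].
  rewrite probability_setC; last exact: measurable_RV.
  have Cp : (p%:E <= P (X i @^-1` C))%E.
    by rewrite PXC -/V VE inver gt_eqF// lee_pdivlMr// -VE.
  rewrite -(fineK (fin_num_measure P _ (measurable_RV i mC))) in Cp *.
  rewrite -EFinB lee_fin in Cp *.
  by apply: le_trans (expR_ge1Dx _); rewrite lerD2l lerN2.
have mXC i : measurable (X i @^-1` (~` C)).
  by apply: measurable_RV; exact: measurableC.
rewrite (eq_bigr (fun i => (fine (P (X i @^-1` (~` C))))%:E)); last first.
  by move=> i _; rewrite fineK// fin_num_measure.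
rewrite prodEFin lee_fin -mulNr expRM_natr.
rewrite (eq_bigl xpredT) => [|i]; last by rewrite finset.in_setT.
rewrite -[in leRHS](card_ord N) -prodr_const; apply: ler_prod => i _.
by rewrite fine_ge0//= -lee_fin fineK ?fin_num_measure.
Qed.

Lemma prob_miss_some (I : finType) (C : I -> set 'rV[R]_n) (p : R) :
  (forall f, measurable (C f)) -> (forall f, C f `<=` unit_ball R n) ->
  (forall f, p%:E * V <= lebesgue_measure_rV n (C f))%E ->
  (P (\big[setU/set0]_f \bigcap_i (X i @^-1` (~` C f))) <=
   (#|I|%:R * expR (- (p * N%:R)))%:E)%E.
Proof.
move=> mC CB pC.
have mM f : measurable (\bigcap_i (X i @^-1` (~` C f))).
  apply: fin_bigcap_measurable => // i _; apply: measurable_RV.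
  exact: measurableC.
have := measure_setU_bigsetU_le (mu := P) measurable0 mM (a := 0%E)
  (b := fun=> (expR (- (p * N%:R)))%:E).
rewrite set0U add0e sumEFin sumr_const mulr_natl; apply.
  by rewrite measure0.
by move=> f; exact: prob_miss.
Qed.

(** With probability close to 1 every cone shell of a net contains a point, by
    the union bound over the [(2k + 1)^n] directions; the hull then contains a
    ball of radius close to 1. *)
Lemma expected_volume_ratio_ge_net (k : nat) (s rho delta : R) :
  (0 < n)%N -> (0 < N)%N -> (0 < k)%N ->
  0 < s < 1 -> 0 < rho <= 1 -> 0 <= delta -> n%:R <= (k%:R * delta) ^+ 2 ->
  0 < s * (1 - rho ^+ 2 / 2) - delta ->
  (((s * (1 - rho ^+ 2 / 2) - delta) ^+ n *
    (1 - (2 * k).+1%:R ^+ n *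
         expR (- ((1 - s) * (rho / 4) ^+ n * N%:R))))%:E <=
   expected_volume_ratio)%E.
Proof.
move=> n0 N0 k0 s01 rho01 d0 nkd; set r := _ - _ => r0.
have [U [U1 net]] := sphere_net n0 k0 d0 nkd.
have /andP[s0 s1] := s01; have /andP[rho0 rho1] := rho01.
pose C f := cone_shell (U f) s rho.
have mC f : measurable (C f) by exact: measurable_cone_shell.
pose miss := \big[setU/set0]_f \bigcap_i (X i @^-1` (~` C f)).
have mmiss : measurable miss.
  apply: bigsetU_measurable => f _; apply: fin_bigcap_measurable => // i _.
  by apply: measurable_RV; exact: measurableC.
have Pmiss : (P miss <= ((2 * k).+1%:R ^+ n *
         expR (- ((1 - s) * (rho / 4) ^+ n * N%:R)))%:E)%E.
  apply: le_trans (prob_miss_some (p := (1 - s) * (rho / 4) ^+ n) mC _ _) _.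
  - by move=> f y [[]].
  - by move=> f; exact: cone_shell_volume.
  by rewrite lee_fin card_ffun !card_ord natrX.
apply: le_trans (expected_volume_ratio_ge (measurableC mmiss) r0 _).
  rewrite EFinM lee_wpmul2l ?lee_fin ?exprn_ge0 ?(ltW r0)//.
  rewrite probability_setC//.
  rewrite -(fineK (fin_num_measure P _ mmiss)) in Pmiss *.
  by rewrite lee_fin in Pmiss; rewrite -EFinB lee_fin lerD2l lerN2.
move=> w wm; apply: cone_shells_hit_supset_eball net _ => //.
  have : rho ^+ 2 <= 1 by rewrite expr_le1// ltW.
  lra.
move=> f; apply: contrapT => nof; apply: wm.
rewrite /miss -bigcup_seq; exists f; first by rewrite /= mem_index_enum.
by move=> i _ Ci; apply: nof; exists i.
Qed.

End random_points_in_the_ball.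

(** * Choice of the parameters *)

Section rates.
Context {R : realType}.
Variables (eps : R) (n N : nat).
Hypothesis eps01 : 0 < eps < 1.
Hypothesis n0 : (0 < n)%N.
Let L : R := ln n%:R.

Let nE : expR L = n%:R. Proof. by rewrite lnK// posrE ltr0n. Qed.
Let L_le : L <= n%:R. Proof. by apply/ltW/ln_sublinear; rewrite ltr0n. Qed.
Let n1 : (1 : R) <= n%:R. Proof. by rewrite ler1n. Qed.
Let eps0 : 0 < eps. Proof. by case/andP: eps01. Qed.
Let eps1 : eps < 1. Proof. by case/andP: eps01. Qed.

Lemma expR_1_ge2 : (2 : R) <= expR 1.
Proof. by have := @expR_ge1Dx R 1; lra. Qed.

Lemma expR_2_ge4 : (4 : R) <= expR 2.
Proof.
have -> : expR (2 : R) = expR 1 * expR 1 by rewrite -expRD.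
by have := expR_1_ge2; nra.
Qed.

(** Here the radius is [1 - b] with [b = n^(-(1 - eps/2))], large enough for
    [(1 - b)^n] to vanish, and [s^2 = e b >= 2 b >= 1 - (1 - b)^2].  Since [s^n]
    is [n^(- (1 - eps/2) n / 2)] up to an exponential factor, it beats
    [N <= n^((1 - eps) (n + 1) / 2)]. *)
Lemma subcritical_rate : 10 <= eps * L ->
  N%:R <= expR ((1 - eps) * (n.+1%:R / 2) * L) ->
  (1 - expR (- ((1 - eps / 2) * L))) ^+ n +
    N%:R * expR ((1 - (1 - eps / 2) * L) / 2) ^+ n <= 2 * expR (- (eps / 2 * L)).
Proof.
move=> epsL NL; have e0 := eps0; have e1 := eps1; have nR := n1; have Ln := L_le.
have L0 : 0 < L by nra.
set b := expR (- ((1 - eps / 2) * L)).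
have b1 : b <= 1 by rewrite -expR0 ler_expR; nra.
have Ele : eps / 2 * L <= n%:R by nra.
suff [h1 h2] : (1 - b) ^+ n <= expR (- (eps / 2 * L)) /\
  N%:R * expR ((1 - (1 - eps / 2) * L) / 2) ^+ n <= expR (- (eps / 2 * L)).
  rewrite [leRHS]mulr_natl [leRHS]mulr2n; exact: lerD.
split.
  apply: (@le_trans _ _ (expR (- b) ^+ n)).
    rewrite lerXn2r ?nnegrE ?subr_ge0 ?expR_ge0//.
    exact: expR_ge1Dx.
  rewrite -expRM_natr ler_expR mulNr lerN2 -[X in _ <= _ * X]nE -expRD.
  rewrite (_ : - _ + L = eps / 2 * L); last by ring.
  by have := expR_ge1Dx (eps / 2 * L); lra.
rewrite -expRM_natr.
apply: (@le_trans _ _ (expR ((1 - eps) * (n.+1%:R / 2) * L) *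
    expR ((1 - (1 - eps / 2) * L) / 2 * n%:R))).
  by rewrite ler_wpM2r ?expR_ge0.
rewrite -expRD ler_expR -[n.+1%:R]natr1.
have : n%:R * 10 <= n%:R * (eps * L) by rewrite ler_wpM2l//.
move: (n%:R : R) nR Ln => x x1 Lx; nra.
Qed.

(** Here [a = n^(-(1 + eps/2))] is the common scale of the shell, of the squared
    angular radius of the cones and of the net.  It satisfies [n a -> 0], so the
    radius [r >= 1 - 5 a / 2] has [r^n -> 1], while the expected number
    of points in a cone is at least [exp n], which beats the logarithm
    of the number [(2 n^2 + 1)^n] of cones. *)
Lemma supercritical_rate : 16 <= eps * L -> (36 <= n)%N ->
  expR (- (eps / 2 * L)) <= 1 / 5 ->
  expR ((1 + eps) * (n.+1%:R / 2) * L) <= N%:R ->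
  let a := expR (- ((1 + eps / 2) * L)) in
  let rho := expR (- ((1 + eps / 2) * L / 2)) in
  let r := (1 - a) * (1 - rho ^+ 2 / 2) - a in
  [/\ a <= 1 / 5, rho ^+ 2 = a, n%:R <= ((n ^ 2)%:R * a) ^+ 2, 0 < r &
   1 - 4 * expR (- (eps / 2 * L)) <=
   r ^+ n * (1 - (2 * n ^ 2).+1%:R ^+ n *
     expR (- ((1 - (1 - a)) * (rho / 4) ^+ n * N%:R)))].
Proof.
move=> epsL n36 q5 NL a rho r.
have e0 := eps0; have e1 := eps1; have nR := n1; have Ln := L_le.
have L0 : 0 < L by nra.
set q := expR (- (eps / 2 * L)) in q5 *.
have q0 : 0 < q by exact: expR_gt0.
have a0 : 0 < a by exact: expR_gt0.
have aq : n%:R * a = q by rewrite -nE -expRD; congr expR; ring.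
have a5 : a <= 1 / 5 by nra.
have rho2 : rho ^+ 2 = a.
  by rewrite -expRM_natl; congr expR; field.
have rE : 1 - 5 / 2 * a <= r by rewrite /r rho2; nra.
have r0 : 0 < r by lra.
split=> //.
  rewrite natrX exprMn -exprM /a -[X in X ^+ _]nE -[leLHS]nE.
  rewrite -!expRM_natl -expRD ler_expR; nra.
have rn : 1 - 5 / 2 * q <= r ^+ n.
  apply: (@le_trans _ _ ((1 - 5 / 2 * a) ^+ n)); last first.
    by rewrite lerXn2r ?nnegrE//; lra.
  rewrite -aq.
  (* Bernoulli's inequality. *)
  have bern m : 1 - 5 / 2 * (m%:R * a) <= (1 - 5 / 2 * a) ^+ m.
    elim: m => [|m IH]; first by rewrite expr0; lra.
    have x0 : 0 <= 1 - 5 / 2 * a by lra.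
    rewrite exprS -[m.+1%:R]natr1; apply: le_trans (ler_wpM2l x0 IH).
    have : 0 <= m%:R * (a * a) by rewrite !mulr_ge0 ?(ltW a0).
    lra.
  exact: bern.
suff miss : (2 * n ^ 2).+1%:R ^+ n *
     expR (- ((1 - (1 - a)) * (rho / 4) ^+ n * N%:R)) <= q.
  move: rn miss; move: (r ^+ n) (_ * expR _) => x y xq yq; nra.
(* The expected number of points in a cone. *)
have NP : expR n%:R <= (1 - (1 - a)) * (rho / 4) ^+ n * N%:R.
  have r4 : expR (- ((1 + eps / 2) * L / 2) - 2) <= rho / 4.
    rewrite expRD ler_pM2l ?expR_gt0// expRN lef_pV2 ?posrE ?expR_gt0//.
    exact: expR_2_ge4.
  apply: (@le_trans _ _ (a * expR (- ((1 + eps / 2) * L / 2) - 2) ^+ n *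
    expR ((1 + eps) * (n.+1%:R / 2) * L))); last first.
    rewrite (_ : 1 - (1 - a) = a); last by ring.
    apply: ler_pM => //; first by rewrite mulr_ge0 ?exprn_ge0 ?expR_ge0.
    rewrite ler_pM2l// lerXn2r ?nnegrE ?expR_ge0 ?divr_ge0 ?expR_ge0//.
  rewrite -expRM_natr -!expRD ler_expR -[n.+1%:R]natr1; nra.
apply: (@le_trans _ _ (expR (n%:R * (2 + 2 * L)) * expR (- expR n%:R))).
  apply: ler_pM; rewrite ?exprn_ge0 ?expR_ge0 ?ler_expR ?lerN2//.
  rewrite expRM_natl lerXn2r ?nnegrE ?expR_ge0// expRD.
  rewrite (expRM_natl 2 L) nE.
  rewrite -[(2 * n ^ 2).+1%:R]natr1 natrM natrX.
  have := expR_2_ge4; nra.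
rewrite -expRD ler_expR.
(* [expR n >= n^3 / 6 >= 6 n^2], while the positive term is at most [4 n^2]. *)
have := expR_ge1Dxn 2 (ler0n R n).
have n36R : (36 : R) <= n%:R by rewrite (ler_nat R 36).
rewrite (_ : 3`!%:R = 6 :> R)//.
have : n%:R ^+ 3 / 6 >= 6 * n%:R ^+ 2 :> R.
  rewrite ler_pdivlMr// exprS; nra.
nra.
Qed.

End rates.

(** * The limits *)

Section limits.
Context {R : realType}.

Lemma mul_ln_natr_cvgy (c : R) : 0 < c -> c * ln n%:R @[n --> \oo] --> +oo.
Proof.
move=> c0; apply/cvgryPge => A; near=> n.
have An : expR (A / c) <= n%:R by near: n; exact: nbhs_infty_ger.
have n0 : (0 : R) < n%:R by exact: lt_le_trans (expR_gt0 _) An.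
by rewrite mulrC -ler_pdivrMr// -ler_expR lnK.
Unshelve. all: by end_near. Qed.

Lemma expR_Nln_cvg0 (c : R) : 0 < c -> expR (- (c * ln n%:R)) @[n --> \oo] --> 0.
Proof.
move=> c0; have cy := mul_ln_natr_cvgy c0.
exact: (cvg_comp _ (fun x : R => expR (- x)) cy (@cvgr_expR R)).
Qed.

End limits.

Theorem corollary1p2 (R : realType) (eps : R) (N : nat -> nat)
    (d : nat -> measure_display) (T : forall n, measurableType (d n))
    (P : forall n, probability (T n) R)
    (X : forall n, 'I_(N n) -> {RV (P n) >-> 'rV[R]_n}) :
  0 < eps < 1 ->
  (forall n, (n < N n)%N) ->
  (forall n, mutually_independent (X n)) ->
  (forall n i, uniformly_distributed (X n i) (unit_ball R n)) ->
  (* fine is harmless: a polytope has finite volume. *)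
  let ratio n : \bar R :=
    ('E_(P n)[fun w => fine (lebesgue_measure_rV n (random_polytope (X n) w))] /
     lebesgue_measure_rV n (unit_ball R n))%E in
  ((\forall n \near \oo,
      (N n)%:R <= expR ((1 - eps) * (n.+1%:R / 2) * ln n%:R)) ->
   ratio n @[n --> \oo] --> 0%E) /\
  ((\forall n \near \oo,
      expR ((1 + eps) * (n.+1%:R / 2) * ln n%:R) <= (N n)%:R) ->
   ratio n @[n --> \oo] --> 1%E).
Proof.
move=> eps01 nN Xindep Xunif ratio.
have /andP[eps0 eps1] := eps01.
have ratioE n : ratio n = expected_volume_ratio (X n) by [].
have eps_ln (K : R) : \forall n \near \oo, K <= eps * ln n%:R.
  exact: (cvgry_ge (mul_ln_natr_cvgy eps0)).
pose q n : R := expR (- (eps / 2 * ln n%:R)).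
have q0 : q n @[n --> \oo] --> 0 by apply: expR_Nln_cvg0; lra.
split=> NL.
  apply: (@squeeze_cvge _ _ _ _ (cst 0%E) _ (fun n => (2 * q n)%:E)); last 2 first.
  - exact: cvg_cst.
  - apply: cvg_EFin; first exact: nearW.
    rewrite -(mulr0 2); apply: cvgMr; exact: q0.
  near=> n; apply/andP; split.
    by rewrite ratioE; exact: expected_volume_ratio_ge0.
  have n0 : (0 < n)%N by near: n; exact: nbhs_infty_gt.
  have epsL : 10 <= eps * ln n%:R by near: n; exact: eps_ln.
  have Nle : (N n)%:R <= expR ((1 - eps) * (n.+1%:R / 2) * ln n%:R).
    by near: n.
  have := subcritical_rate eps01 n0 epsL Nle; rewrite -lee_fin; apply: le_trans.
  apply: expected_volume_ratio_le_shell => //.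
  - rewrite subr_gt0 expR_lt1; nra.
  - exact: expR_gt0.
  - rewrite -expRM_natl (_ : 2%:R * _ = 1 + - ((1 - eps / 2) * ln n%:R)).
      rewrite expRD; have := @expR_1_ge2 R.
      have := expR_gt0 (- ((1 - eps / 2) * ln n%:R)); nra.
    by field.
apply: (@squeeze_cvge _ _ _ _ (fun n => (1 - 4 * q n)%:E) _ (cst 1%E)); last 2 first.
- apply: cvg_EFin; first exact: nearW.
  rewrite -[X in _ --> X](subr0 1); apply: cvgB; first exact: cvg_cst.
  rewrite -(mulr0 4); apply: cvgMr; exact: q0.
- exact: cvg_cst.
near=> n; apply/andP; split; last first.
  by rewrite ratioE; exact: expected_volume_ratio_le1.
have n36 : (36 <= n)%N by near: n; exact: nbhs_infty_ge.
have n0 : (0 < n)%N by exact: leq_trans n36.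
have epsL : 16 <= eps * ln n%:R by near: n; exact: eps_ln.
have q5 : q n <= 1 / 5.
  near: n; move/cvgrPdist_le : q0 => /(_ (1 / 5)) [|k _ hk]; first lra.
  exists k => // n /hk /=; rewrite sub0r normrN ger0_norm ?expR_ge0//.
have Nge : expR ((1 + eps) * (n.+1%:R / 2) * ln n%:R) <= (N n)%:R by near: n.
have [a5 rho2 net r0 rate] := supercritical_rate eps01 n0 epsL n36 q5 Nge.
move: a5 rho2 net r0 rate; set a := expR (- ((1 + eps / 2) * _)).
set rho := expR _ => a5 rho2 net r0 rate.
rewrite -lee_fin in rate; apply: le_trans rate _.
have a0 : 0 < a := expR_gt0 _.
apply: expected_volume_ratio_ge_net => //.
- exact: leq_ltn_trans (nN n).
- by rewrite expn_gt0 n0.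
- by apply/andP; split; lra.
- rewrite expR_gt0/=; have := expR_gt0 (- ((1 + eps / 2) * ln n%:R / 2)); rewrite -/rho.
  nra.
- exact: ltW.
Unshelve. all: by end_near. Qed.
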